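(* Let $\widetilde V=\sum_{j=1}^J\widetilde V_j$ be a subspace decomposition, and assume that there are constants $C_{\rm st}>0$ and $C_{\rm reg}>0$ such that: (A1) for every $v\in\widetilde V\cap V^\perp$ there exist $v_j\in\widetilde V_j$ $(1\le j\le J)$ with $v=\sum_{j=1}^Jv_j$ and $\sum_{j=1}^J\|v_j\|_a^2\le C_{\rm st}\|v\|_a^2$; (A2) for every $v\in\widetilde V$ and all $v_j\in\widetilde V_j$ with $v=\sum_{j=1}^Jv_j$, one has $\|v\|_a^2\le C_{\rm reg}\sum_{j=1}^J\|v_j\|_a^2$. Let $m\ge1$ be an integer and let $R_mu_h$ be the output of $m$ steps of the preconditioned conjugate gradient iteration with initial guess $u_h$ and preconditioner $S=S_{\rm add}$ or $S=\bar S_{\rm mult}$. Then $$\|u-R_mu_h\|_a\le(1+\varepsilon_m)\|u-\tilde u_h\|_a+\varepsilon_m\|u-u_h\|_a,$$ where $\varepsilon_m=\sqrt{C_{\rm reg}C_{\rm st}}/(2m+1)$ for $S=S_{\rm add}$ and $\varepsilon_m=\sqrt{C_{\rm st}M^2}/(2m+1)$ for $S=\bar S_{\rm mult}$.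
   Context: $V\subset\widetilde V$ are finite-dimensional real vector spaces (finite element spaces), and $a:\widetilde V\times\widetilde V\to\mathbb R$ is a symmetric, coercive (positive-definite) bilinear form with energy norm $\|v\|_a=\sqrt{a(v,v)}$. $V^\perp$ is the orthogonal complement of $V$ in $\widetilde V$ with respect to $a(\cdot,\cdot)$. $\widetilde V'$ is the dual of $\widetilde V$ and $\langle\cdot,\cdot\rangle$ the duality pairing. The operator $A:\widetilde V\to\widetilde V'$ is defined by $\langle Av,w\rangle=a(v,w)$. Given $f\in V'$ and $\tilde f\in\widetilde V'$ with $\tilde f|_V=f$, $u_h\in V$ solves $a(u_h,v)=f(v)$ for all $v\in V$, and $\tilde u_h\in\widetilde V$ solves $a(\tilde u_h,v)=\tilde f(v)$ for all $v\in\widetilde V$. The element $u$ is the exact solution being approximated; it may lie outside $\widetilde V$, and $\|\cdot\|_a$ is understood to extend to a seminorm on $\widetilde V+\mathrm{span}\{u\}$ that agrees with the energy norm on $\widetilde V$. Preconditioned conjugate gradient iteration with preconditioner $S:\widetilde V'\to\widetilde V$: set $u_0=u_h$, $r_0=\tilde f-Au_h$, $p_0=z_0=Sr_0$. For $k=1,\dots,m$: $\alpha_k=\langle r_{k-1},z_{k-1}\rangle/\langle Ap_{k-1},p_{k-1}\rangle$; $u_k=u_{k-1}+\alpha_kp_{k-1}$; $r_k=r_{k-1}-\alpha_kAp_{k-1}$; $z_k=Sr_k$; $\beta_k=\langle r_k,z_k\rangle/\langle r_{k-1},z_{k-1}\rangle$; $p_k=z_k+\beta_kp_{k-1}$. The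 output is $R_mu_h=u_m$. If some residual $r_k$ vanishes, the iteration stops and the current iterate $u_k$ is returned as $R_mu_h$. The subspaces $\widetilde V_j\subset\widetilde V$ need not form a direct sum. Additive smoother: for $r\in\widetilde V'$, let $e_j\in\widetilde V_j$ solve $a(e_j,v_j)=r(v_j)$ for all $v_j\in\widetilde V_j$, $1\le j\le J$; then $S_{\rm add}r=\sum_{j=1}^Je_j$. Multiplicative smoother: set $e_0=0$; for $j=1,\dots,J$ let $\eta_j\in\widetilde V_j$ solve $a(\eta_j,v_j)=r(v_j)-a(e_{j-1},v_j)$ for all $v_j\in\widetilde V_j$ and set $e_j=e_{j-1}+\eta_j$; then $S_{\rm mult}r=e_J$. $S_{\rm mult}^t$ is the same procedure with the subspaces visited in the reverse order $j=J,\dots,1$. The symmetrized multiplicative smoother is $\bar S_{\rm mult}=S_{\rm mult}+S_{\rm mult}^t-S_{\rm mult}^tAS_{\rm mult}$. $P_j:\widetilde V\to\widetilde V_j$ is the $a(\cdot,\cdot)$-orthogonal projection, and $M=\max_{1\le j\le J}\#\{1\le i\le J: P_i\widetilde V_j\ne\{0\}\}$. *)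

(* Defs.v *)
From HB Require Import structures.
From mathcomp Require Import all_boot all_order all_algebra.
From mathcomp Require Import all_classical all_reals.

Set Implicit Arguments.
Unset Strict Implicit.
Unset Printing Implicit Defensive.

Import Order.TTheory GRing.Theory Num.Theory.
Local Open Scope classical_set_scope.
Local Open Scope ring_scope.

(* Throughout, the type W is the larger space, its subspaces are elements of
   {vspace W}, and its dual is 'Hom(W, R^o); the duality pairing <r, w> is the
   application r w. A symmetric positive definite bilinear form on W is an
   element of {dot W for idfun}. *)

Section EnergyForm.
Variables (R : realType) (W : vectType R) (a : {dot W for idfun}).
Implicit Types (U : {vspace W}) (r : 'Hom(W, R^o)) (v w e : W).

Definition energy_norm v : R := Num.sqrt (a v v).

Definition energy_op v : 'Hom(W, R^o) := linfun (a v : W -> R^o).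

Lemma energy_opE v w : energy_op v w = a v w.
Proof. exact: lfunE. Qed.

Definition galerkin_sol U r : set W :=
  [set e | e \in U /\ forall v, v \in U -> a e v = r v].

Definition galerkin U r : W := xget 0 (galerkin_sol U r).

Definition aproj U v : W :=
  xget 0 [set p | p \in U /\ v - p \in orthov a U].

Let T U (e : subvs_of U) : 'Hom(subvs_of U, R^o) :=
  (energy_op (vsval e) \o linfun (@vsval _ _ U))%VF.

Let TE U (e z : subvs_of U) : T e z = a (vsval e) (vsval z).
Proof. by rewrite /T lfunE /= energy_opE lfunE. Qed.

Let T_is_linear U : linear (@T U).
Proof.
move=> k x y; apply/lfunP => z.
by rewrite add_lfunE scale_lfunE !TE linearPl.
Qed.

Lemma galerkinP U r :
  galerkin U r \in U /\ forall v, v \in U -> a (galerkin U r) v = r v.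
Proof.
suff [e eU] : exists e, galerkin_sol U r e.
  exact: (@xgetPex _ 0 (galerkin_sol U r) (ex_intro _ e eU)).
pose Tm := GRing.isLinear.Build _ _ _ _ (@T U) (@T_is_linear U).
pose Tl : {linear subvs_of U -> 'Hom(subvs_of U, R^o)} := HB.pack (@T U) Tm.
have ker0 : lker (linfun Tl) == 0%VS.
  apply/lker0P => x y; rewrite !lfunE /= => Exy.
  apply/eqP; rewrite -subr_eq0; apply: contraT => xy0.
  have: 0 < a (vsval (x - y)) (vsval (x - y)).
    apply: neq0_dnorm_gt0; apply: contra xy0 => /eqP xy0.
    exact/eqP/val_inj.
  have T0 : T (x - y) = 0.
    by apply: etrans (linearB Tl x y) _; apply/eqP; rewrite subr_eq0; apply/eqP; exact: Exy.
  by rewrite -TE T0 zero_lfunE ltxx.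
have img : limg (linfun Tl) = fullv.
  apply/eqP; rewrite eqEdim subvf /= limg_dim_eq ?(eqP ker0) ?capv0 //.
  by rewrite !dimvf /dim /= muln1.
have : (r \o linfun (@vsval _ _ U))%VF \in limg (linfun Tl).
  by rewrite img memvf.
case/memv_imgP => x _ Ex; exists (vsval x); split; first exact: subvsP.
move=> v vU; move: Ex; rewrite lfunE /= => /lfunP/(_ (Subvs vU)).
by rewrite TE lfunE /= lfunE.
Qed.

Lemma galerkin_uniq U r e :
  e \in U -> (forall v, v \in U -> a e v = r v) -> e = galerkin U r.
Proof.
move=> eU eE; have [gU gE] := galerkinP U r.
apply/eqP; rewrite -subr_eq0; apply: contraT => /(@neq0_dnorm_gt0 _ _ _ a).
by rewrite {1}linearBl /= eE ?gE ?rpredB // subrr ltxx.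
Qed.

Lemma aprojP U v : aproj U v \in U /\ v - aproj U v \in orthov a U.
Proof.
apply: (@xgetPex _ 0 [set p | p \in U /\ v - p \in orthov a U]).
have [gU gE] := galerkinP U (energy_op v).
exists (galerkin U (energy_op v)); split=> //; apply/mem_orthovP => w wU.
by rewrite linearBl /= gE // energy_opE subrr.
Qed.

End EnergyForm.

Section Smoothers.
Variables (R : realType) (W : vectType R) (a : {dot W for idfun}).
Variables (J : nat) (Ws : 'I_J -> {vspace W}).
Implicit Type r : 'Hom(W, R^o).

Definition Sadd r : W := \sum_(j < J) galerkin a (Ws j) r.

Definition sweep (s : seq 'I_J) r : W :=
  foldl (fun e j => e + galerkin a (Ws j) (r - energy_op a e)) 0 s.

Definition Smult r : W := sweep (enum 'I_J) r.

Definition Smult_t r : W := sweep (rev (enum 'I_J)) r.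

Definition Smult_sym r : W :=
  Smult r + Smult_t r - Smult_t (energy_op a (Smult r)).

Definition max_overlap : nat :=
  \max_(j < J) #|[pred i : 'I_J |
    aproj a (Ws i) @` [set` Ws j] != [set 0%R : W]]|.

End Smoothers.

Section PCG.
Variables (R : realType) (W : vectType R) (a : {dot W for idfun}).
Variable S : 'Hom(W, R^o) -> W.

Record pcg_state := PcgState {
  pcg_u : W; pcg_r : 'Hom(W, R^o); pcg_p : W; pcg_z : W }.

Definition pcg_init (ft : 'Hom(W, R^o)) (u0 : W) : pcg_state :=
  let r0 := ft - energy_op a u0 in
  PcgState u0 r0 (S r0) (S r0).

(* A vanishing residual freezes the state, so that further steps return the
   iterate at which the iteration stopped. *)
Definition pcg_step (st : pcg_state) : pcg_state :=
  let: PcgState u r p z := st in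
  if r == 0 then st else
  let alpha : R := r z / energy_op a p p in
  let u' := u + alpha *: p in
  let r' := r - alpha *: energy_op a p in
  let z' := S r' in
  let beta : R := r' z' / r z in
  PcgState u' r' (z' + beta *: p) z'.

Definition pcg (ft : 'Hom(W, R^o)) (m : nat) (u0 : W) : W :=
  pcg_u (iter m pcg_step (pcg_init ft u0)).

End PCG.

(* iota embeds W into a space E containing u; N is only constrained on
   iota(W) + span{u}. *)
Definition energy_seminorm_ext (R : realType) (W : vectType R)
    (a : {dot W for idfun}) (E : lmodType R) (iota : W -> E) (u : E)
    (N : E -> R) : Prop :=
  let D := [set x | exists v (c : R), x = iota v + c *: u] in
  [/\ forall x, D x -> 0 <= N x,
      forall (c : R) x, D x -> N (c *: x) = `|c| * N x,
      forall x y, D x -> D y -> N (x + y) <= N x + N y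
    & forall v, N (iota v) = energy_norm a v].

(* Main.v *)
From HB Require Import structures.
Require Import Defs.
From mathcomp Require Import all_boot all_order all_algebra.
From mathcomp Require Import all_classical all_reals.
From mathcomp Require Import ring lra.

Set Implicit Arguments.
Unset Strict Implicit.
Unset Printing Implicit Defensive.

Import Order.TTheory GRing.Theory Num.Theory.
Local Open Scope ring_scope.

(** Write A for the energy operator, B = S A for the preconditioned operator
    and e_0 for the difference of the two Galerkin solutions uht and uh. The
    form a is positive definite and B is self-adjoint for it. Galerkin
    orthogonality puts e_0 in the orthogonal complement of V, so the stable
    decomposition of hypothesis A1 is available for e_0. After a triangle
    inequality for the seminorm ([seminorm_transfer]) it remains to see that m
    steps of the iteration multiply the energy norm of the error e_0 by at most
    eps. Three facts give this.

    Optimality ([pcg_optimal]). The error after m steps is the element of least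
    energy norm in e_0 + K_m, where K_m is the Krylov space spanned by
    B e_0, ..., B^m e_0.

    A good competitor ([chebyshev_bound]). If 0 <= B <= L, the polynomial q
    with T_(2m+1)(x) = x q(x^2) satisfies t q(t)^2 <= 1 on [0, 1] and
    q(0) = (-1)^m (2m+1). Writing e_0 = B g, the vector q(B/L) e_0 / q(0) is in
    e_0 + K_m and its squared energy norm is at most
    L a(g, B g) / (2m+1)^2. No spectral decomposition is needed for this:
    the identity t q^2 + (1 - t) w^2 = 1, where U_(2m)(x) = w(x^2), becomes a
    quadratic form that stays constant along the recurrence for the vectors
    q(B/L) g and w(B/L) g ([chebyshev_step]).

    Stability. For g and v_j in the j-th subspace,
    2 a(g, sum_j v_j) <= a(g, B g) + c sum_j |v_j|^2, with c = 1 for the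
    additive smoother ([add_op_stable]) and c = M^2 for the multiplicative one
    ([mult_op_stable]). Applied to the stable decomposition of e_0 = B g it
    yields a(g, B g) <= c Cst |e_0|^2. It also shows that B is definite, hence
    invertible, so that g exists.

    The upper bound L is Creg in the additive case, which is A2 applied to the
    decomposition of B v into its local corrections, and 1 in the multiplicative
    case, where B = 1 - G' G for the error propagation G of one sweep and its
    adjoint G', both contractions. In both cases
    eps^2 = L c Cst / (2m+1)^2. *)

(** * The energy inner product *)

Section EnergyInnerProduct.
Variables (R : realType) (W : vectType R) (a : {dot W for idfun}).
Implicit Types (u v w : W) (k : R).

Lemma energyC u v : a u v = a v u.
Proof. by rewrite hermC expr0 mul1r. Qed.

Lemma energyDl u v w : a (u + v) w = a u w + a v w.
Proof. by rewrite linearDl. Qed.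

Lemma energyNl u w : a (- u) w = - a u w.
Proof. by rewrite linearNl. Qed.

Lemma energyZl k u w : a (k *: u) w = k * a u w.
Proof. by rewrite linearZl_LR. Qed.

Lemma energyDr u v w : a w (u + v) = a w u + a w v.
Proof. by rewrite linearDr. Qed.

Lemma energyNr u w : a w (- u) = - a w u.
Proof. by rewrite linearNr. Qed.

Lemma energyZr k u w : a w (k *: u) = k * a w u.
Proof. by rewrite energyC energyZl energyC. Qed.

Lemma energy0l u : a 0 u = 0. Proof. by rewrite linear0l. Qed.
Lemma energy0r u : a u 0 = 0. Proof. by rewrite linear0r. Qed.

Definition energy_linE :=
  (energyDl, energyDr, energyNl, energyNr, energyZl, energyZr).

Lemma energy_sumr (I : finType) w (F : I -> W) :
  a w (\sum_i F i) = \sum_i a w (F i).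
Proof. by rewrite linear_sumr. Qed.

Lemma energy_gt0 v : v != 0 -> 0 < a v v.
Proof. exact: neq0_dnorm_gt0. Qed.

Lemma energy_ge0 v : 0 <= a v v.
Proof. by have [->|/energy_gt0/ltW//] := eqVneq v 0; rewrite energy0l. Qed.

Lemma energy_eq0 v : (a v v == 0) = (v == 0).
Proof.
have [->|/energy_gt0/gt_eqF->//] := eqVneq v 0.
by rewrite energy0l eqxx.
Qed.

Lemma energy_inj u v : (forall w, a u w = a v w) -> u = v.
Proof.
move=> uv; apply/eqP; rewrite -subr_eq0 -energy_eq0.
by rewrite !(energyDl _ (- v)) !energyNl uv subrr.
Qed.

Lemma energy_normE v : energy_norm a v ^+ 2 = a v v.
Proof. by rewrite sqr_sqrtr ?energy_ge0. Qed.

Lemma energy_op_eq0 v : (energy_op a v == 0) = (v == 0).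
Proof.
apply/eqP/eqP => [Av0|->]; last first.
  by apply/lfunP => w; rewrite energy_opE energy0l zero_lfunE.
by apply: energy_inj => w; rewrite -energy_opE Av0 zero_lfunE energy0l.
Qed.

Lemma energy_op_sub_scale u v k :
  energy_op a u - k *: energy_op a v = energy_op a (u - k *: v).
Proof.
apply/lfunP => w; rewrite add_lfunE opp_lfunE scale_lfunE !energy_opE.
by rewrite !energy_linE.
Qed.

End EnergyInnerProduct.

(** * Optimality of the conjugate gradient iterates *)

Section PCG.
Variables (R : realType) (W : vectType R) (a : {dot W for idfun}).
Variables (S : 'Hom(W, R^o) -> W) (B : 'End(W)).
Hypothesis SB : forall v, S (energy_op a v) = B v.
Hypothesis B_sym : forall v w, a (B v) w = a v (B w).
Hypothesis B_gt0 : forall v, v != 0 -> 0 < a v (B v).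
Implicit Types (e v w : W) (K : {vspace W}).

(** The span of B e, ..., B^k e; the recursive form makes it evident
    that these spaces increase and that B maps each one, enlarged by e, into the
    next. *)
Fixpoint krylov e k : {vspace W} :=
  if k is k'.+1 then (krylov e k' + (B @: (krylov e k' + <[e]>)))%VS else 0%VS.

Variables (ft : 'Hom(W, R^o)) (uht uh : W).
Hypothesis uht_sol : forall v, a uht v = ft v.

Let st k := iter k (pcg_step a S) (pcg_init a S ft uh).
Let err k := uht - pcg_u (st k).

(** State of the iteration with error e, direction p and search space K: the
    next search space is K + <p>, and optimality of the iterate over K is the
    orthogonality of e to K. Keeping K abstract replaces the usual double family
    of orthogonality relations between all earlier residuals and directions. *)
Definition conjugate K e p :=
  [/\ p - B e \in K, {in K, forall w, a e w = 0}, {in K, forall w, a p w = 0}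
    & {in K, forall w, B w \in (K + <[p]>)%VS}].

(** The new direction is orthogonal to K because B is self-adjoint and maps K
    into K + <p>, to which the new error is orthogonal; the choice of beta makes
    it orthogonal to p as well. *)
Lemma conjugate_step K e e1 p (alpha beta : R) :
  e != 0 -> conjugate K e p -> alpha = a e (B e) / a p p ->
  e1 = e - alpha *: p -> beta = a e1 (B e1) / a e (B e) ->
  conjugate (K + <[p]>)%VS e1 (B e1 + beta *: p).
Proof.
set K1 := (K + <[p]>)%VS; set p1 := B e1 + beta *: p.
move=> e_neq0 [pK eK pKo BK] alphaE e1E betaE.
have pK1 : p \in K1 by rewrite -[p]add0r memv_add ?mem0v ?memv_line.
have subK : {subset K <= K1} by move=> w wK; rewrite -[w]addr0 memv_add ?mem0v.
have eBe_gt0 := B_gt0 e_neq0.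
have epE : a e p = a e (B e).
  by rewrite -[p](subrK (B e)) energyDr eK // add0r.
have p_neq0 : p != 0.
  by apply: contraTneq eBe_gt0 => p0; rewrite -epE p0 energy0r ltxx.
have pp_gt0 := energy_gt0 a p_neq0.
have alpha_neq0 : alpha != 0 by rewrite alphaE mulf_neq0 ?invr_eq0 ?gt_eqF.
have e1K1 : {in K1, forall w, a e1 w = 0}.
  move=> _ /memv_addP[w wK [_ /vlineP[k ->] ->]].
  rewrite e1E !energy_linE (eK w) // (pKo w) // epE alphaE.
  by field; rewrite gt_eqF.
have BeK1 : B e \in K1.
  by rewrite -[B e](subKr p) rpredB // subK.
(* The step e1 = e - alpha p expresses B p by two residual images. *)
have BpE : B p = alpha^-1 *: (B e - B e1).
  rewrite -linearB e1E opprB addrC subrK linearZ scalerA mulVf //.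
  by rewrite scale1r.
have p1K1 : {in K1, forall w, a p1 w = 0}.
  move=> _ /memv_addP[w wK [_ /vlineP[k ->] ->]].
  have := e1K1 _ (BK _ wK); rewrite -B_sym => Be1w.
  have Be1p : a (B e1) p = - beta * a p p.
    rewrite B_sym BpE !energy_linE e1K1 // alphaE betaE.
    by field; rewrite !gt_eqF.
  rewrite /p1 !energy_linE Be1w Be1p (pKo w) //; ring.
have p1p1 : p1 \in (K1 + <[p1]>)%VS.
  by rewrite -[p1]add0r memv_add ?mem0v // add0r memv_line.
have subK1 : {subset K1 <= (K1 + <[p1]>)%VS}.
  by move=> w wK; rewrite -[w]addr0 memv_add ?mem0v.
split=> //; first by rewrite addrC addKr rpredZ.
move=> _ /memv_addP[w wK [_ /vlineP[k ->] ->]].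
rewrite linearD rpredD //; first by rewrite subK1 ?BK.
rewrite linearZ rpredZ //= BpE rpredZ // rpredB //; first exact: subK1.
by rewrite -[B e1](addrK (beta *: p)) rpredB // subK1 ?rpredZ.
Qed.

(** In the alternative err k = 0 the residual vanishes and the state is
    frozen. *)
Lemma pcg_invariant k :
  [/\ pcg_r (st k) = energy_op a (err k), pcg_z (st k) = B (err k) &
   err k = 0 \/ exists2 K : {vspace W}, conjugate K (err k) (pcg_p (st k)) &
    [/\ (uht - uh) - err k \in K, (krylov (uht - uh) k <= K)%VS
      & B (uht - uh) \in (K + <[pcg_p (st k)]>)%VS]].
Proof.
elim: k => [|k [rE zE IH]].
  have r0 : ft - energy_op a uh = energy_op a (uht - uh).
    apply/lfunP => w; rewrite add_lfunE opp_lfunE !energy_opE.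
    by rewrite !energy_linE uht_sol.
  rewrite /err /st /= r0 SB; split=> //; right; exists 0%VS.
    split; rewrite ?subrr ?mem0v // => w; rewrite memv0 => /eqP->.
    - by rewrite energy0r.
    - by rewrite energy0r.
    - by rewrite linear0 mem0v.
  by rewrite subrr mem0v subvv add0v memv_line.
have [e0|e_neq0] := eqVneq (err k) 0.
  have stE : st k.+1 = st k.
    rewrite /st iterS -/(st k); move: rE; case: (st k) => x r p z /=.
    rewrite /err in e0; rewrite /err e0 => ->.
    by rewrite energy_op_eq0 eqxx.
  by rewrite /err stE -/(err k); split=> //; left.
case: IH => [e0|[K conjK [e0K krK Be0K]]]; first by rewrite e0 eqxx in e_neq0.
have [_ _ _ BK] := conjK.
rewrite /err /st iterS -/(st k).
have : uht - pcg_u (st k) = err k by [].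
move: e_neq0 rE zE e0K conjK BK Be0K.
move: (err k) => e; case: (st k) => x r p z /=.
move=> e_neq0 -> -> e0K conjK BK Be0K eE.
rewrite energy_op_eq0 (negPf e_neq0) !energy_opE energy_op_sub_scale SB.
rewrite energy_opE /=.
set alpha := a e (B e) / a p p; set e1 := e - alpha *: p.
have -> : uht - (x + alpha *: p) = e1 by rewrite opprD addrA eE.
set beta := _ / a e (B e).
split=> //; right; exists (K + <[p]>)%VS.
  exact: (conjugate_step e_neq0 conjK erefl).
split; last by rewrite -[B _]addr0 memv_add ?mem0v.
  by rewrite opprB addrCA addrC memv_add // rpredZ // memv_line.
rewrite subv_add (subv_trans krK (addvSl _ _)) /=.
apply/subvP => _ /memv_imgP[w /memv_addP[y yK [_ /vlineP[c ->] ->]] ->].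
by rewrite linearD linearZ rpredD ?rpredZ // BK // (subvP krK).
Qed.

(** The vector uht - uh + d differs from the current error by an element of the
    search space, to which that error is orthogonal. *)
Lemma pcg_optimal k d : d \in krylov (uht - uh) k ->
  a (uht - pcg a S ft k uh) (uht - pcg a S ft k uh)
    <= a (uht - uh + d) (uht - uh + d).
Proof.
move=> dK; have [_ _] := pcg_invariant k; rewrite -/(err k).
case=> [->|[K [_ eK _ _] [e0K krK _]]]; first by rewrite energy0l energy_ge0.
set e0 := uht - uh in dK e0K krK *; move: (err k) e0K eK => e e0K eK.
have [c cK ->] : exists2 c, c \in K & e0 + d = e + c.
  exists (e0 - e + d); first by rewrite rpredD // (subvP krK).
  by rewrite addrA [e + _]addrC subrK.
by rewrite !energy_linE (energyC a c e) (eK c) // add0r addr0 lerDl energy_ge0.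
Qed.

End PCG.

(** * Chebyshev competitors and the convergence rate *)

Section Convergence.
Variables (R : realType) (W : vectType R) (a : {dot W for idfun}).
Variables (B : 'End(W)) (L : R).
Hypothesis L_gt0 : 0 < L.
Hypothesis B_sym : forall v w, a (B v) w = a v (B w).
Hypothesis B_le : forall v, a (B v) (B v) <= L * a v (B v).

Lemma krylovS e k : (krylov B e k <= krylov B e k.+1)%VS.
Proof. exact: addvSl. Qed.

Lemma mem_krylovS e k c w : w - c *: e \in krylov B e k ->
  B w \in krylov B e k.+1.
Proof.
move=> wK; apply: (subvP (addvSr _ _)); apply: memv_img.
by rewrite -[w](subrK (c *: e)) memv_add // rpredZ // memv_line.
Qed.

(** Angle addition T_(n+2) = T_2 T_n - 2 x (1 - x^2) U_(n-1) and
    U_(n+1) = 2 x T_n + T_2 U_(n-1), written for n = 2m+1 and t = x^2 on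
    q = T_(2m+1)(x)/x and w = U_(2m)(x), gives
    q' = (2t-1) q - 2 (1-t) w and w' = 2t q + (2t-1) w, here with t = B/L.
    The preserved quantity is t q^2 + (1-t) w^2 in the inner product a(B _, _),
    multiplied by L; its invariance holds for arbitrary vectors x and y,
    since the identity uses only that B is self-adjoint. *)
Lemma chebyshev_step x y (x' := (2 / L) *: B (x + y) - x - 2 *: y)
    (y' := (2 / L) *: B (x + y) - y) :
  a (B x') (B x') + (L * a y' (B y') - a (B y') (B y')) =
  a (B x) (B x) + (L * a y (B y) - a (B y) (B y)).
Proof.
have B_symC u v : a v (B u) = a u (B v) by rewrite energyC B_sym.
have BD u v : B (u + v) = B u + B v by rewrite linearD.
have BN u : B (- u) = - B u by rewrite linearN.
have BZ c u : B (c *: u) = c *: B u by rewrite linearZ.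
rewrite /x' /y' !(BD, BN, BZ) !energy_linE !B_sym.
rewrite !(B_symC x y, B_symC (B x) y, B_symC x (B y), B_symC (B x) (B y)).
rewrite !B_sym !(energyC a y x, energyC a y (B x), energyC a y (B (B x)),
  energyC a y (B (B (B x))), energyC a y (B (B (B (B x))))) !B_sym.
by field; rewrite gt_eqF.
Qed.

(** x = q(B/L) g and y = w(B/L) g; the coefficients of B g are the values
    q(0) = (-1)^m (2m+1) and w(0) = (-1)^m, tracked modulo the Krylov space. *)
Lemma chebyshev_vectors g m : exists x y,
  [/\ B x - ((-1) ^+ m * (2 * m + 1)%:R) *: B g \in krylov B (B g) m,
      B y - (-1) ^+ m *: B g \in krylov B (B g) m &
      a (B x) (B x) + (L * a y (B y) - a (B y) (B y)) = L * a g (B g)].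
Proof.
elim: m => [|m [x [y [xK yK Exy]]]].
  exists g, g; rewrite !expr0 mul1r scale1r subrr mem0v; split=> //.
  by rewrite addrC subrK.
exists ((2 / L) *: B (x + y) - x - 2 *: y), ((2 / L) *: B (x + y) - y).
rewrite chebyshev_step; split=> //.
all: set K := krylov _ _ _.
all: have xyK : B (B (x + y)) \in K by
  apply: (@mem_krylovS _ _ ((-1) ^+ m * (2 * m + 1)%:R + (-1) ^+ m));
  rewrite linearD scalerDl opprD addrACA rpredD.
all: have {}xK := subvP (krylovS _ _) _ xK.
all: have {}yK := subvP (krylovS _ _) _ yK.
- have -> : (-1) ^+ m.+1 * (2 * m.+1 + 1)%:R =
    - ((-1) ^+ m * (2 * m + 1)%:R) - 2 * (-1) ^+ m :> R.
    by rewrite exprS !natrD !natrM -natr1; ring.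
  rewrite !linearB !linearZ /= !scalerBl scaleNr -(scalerA 2 ((-1) ^+ m)).
  rewrite [X in X \in _](_ : _ = (2 / L) *: B (B (x + y))
     - (B x - ((-1) ^+ m * (2 * m + 1)%:R) *: B g)
     - 2 *: (B y - (-1) ^+ m *: B g)).
    by apply: rpredB; [apply: rpredB => //|]; apply: rpredZ.
  rewrite scalerBr !scalerN !opprD !opprK !addrA; congr (_ + _).
  by rewrite addrAC.
rewrite linearB linearZ /= exprS mulN1r scaleNr opprK -addrA rpredD ?rpredZ //.
by rewrite addrC -opprB rpredN.
Qed.

(** The y-part of the preserved quantity is nonnegative because B^2 <= L B, so
    the x-part alone is bounded by its initial value; dividing by q(0) gives the
    competitor. *)
Lemma chebyshev_bound g m : exists2 d, d \in krylov B (B g) m &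
  (2 * m + 1)%:R ^+ 2 * a (B g + d) (B g + d) <= L * a g (B g).
Proof.
have [x [y [xK _ Exy]]] := chebyshev_vectors g m.
set c := (-1) ^+ m * (2 * m + 1)%:R in xK.
have n_neq0 : (2 * m + 1)%:R != 0 :> R by rewrite pnatr_eq0 addn1.
have c_neq0 : c != 0 by rewrite mulf_neq0 // signr_eq0.
exists (c^-1 *: (B x - c *: B g)); first exact: rpredZ.
rewrite scalerBr scalerA mulVf // scale1r addrC subrK !energy_linE -Exy.
have -> : (2 * m + 1)%:R ^+ 2 = c ^+ 2 :> R by rewrite exprMn sqrr_sign mul1r.
rewrite expr2 -mulrA !mulVKf // lerDl subr_ge0.
exact: B_le.
Qed.

Variables (J : nat) (Ws : 'I_J -> {vspace W}) (c : R).
Hypothesis Ws_full : (\sum_(j < J) Ws j)%VS = fullv.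
Hypothesis B_stable : forall g (vs : 'I_J -> W), (forall j, vs j \in Ws j) ->
  2 * a g (\sum_j vs j) <= a g (B g) + c * \sum_j a (vs j) (vs j).

(** If a(v, B v) = 0, stability for a decomposition of v scaled by t compares
    2 t a(v, v) with a multiple of t^2, which forces a(v, v) = 0. *)
Lemma stable_gt0 v : v != 0 -> 0 < a v (B v).
Proof.
move=> v_neq0; rewrite lt_def; have vBv_ge0 : 0 <= a v (B v).
  by rewrite -(pmulr_rge0 _ L_gt0) (le_trans _ (B_le v)) ?energy_ge0.
rewrite vBv_ge0 andbT; apply: contraTneq (energy_gt0 a v_neq0) => vBv0.
have /memv_sumP[vs vsP vE] : v \in (\sum_(j < J) Ws j)%VS.
  by rewrite Ws_full memvf.
set q := a v v; rewrite -leNgt.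
set X := c * \sum_j a (vs j) (vs j).
have scaled t : 2 * t * q <= t ^+ 2 * X.
  have := @B_stable v (fun j => t *: vs j) (fun j => rpredZ _ (vsP j isT)).
  rewrite -scaler_sumr -vE vBv0 add0r energyZr mulrA -/q => /le_trans; apply.
  under eq_bigr do rewrite !energy_linE mulrA -expr2.
  by rewrite -mulr_sumr mulrCA.
have q_ge0 : 0 <= q := energy_ge0 a v.
have [X_le0|X_gt0] := leP X 0.
  by have := scaled 1; rewrite expr1n mul1r mulr1; lra.
apply: contraTT (scaled (q / X)); rewrite -!ltNge => q_gt0.
have -> : 2 * (q / X) * q = 2 * (q ^+ 2 / X) by field; rewrite gt_eqF.
have -> : (q / X) ^+ 2 * X = q ^+ 2 / X by field; rewrite gt_eqF.
have : 0 < q ^+ 2 / X by rewrite divr_gt0 ?exprn_gt0.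
by lra.
Qed.

Lemma stable_surj e : exists g, e = B g.
Proof.
have ker0 : lker B == 0%VS.
  rewrite -subv0; apply/subvP => v; rewrite memv_ker memv0 => /eqP Bv0.
  by apply: contraT => /stable_gt0; rewrite Bv0 energy0r ltxx.
by exists (B^-1%VF e); rewrite lker0_lfunVK.
Qed.

(** Stability with e_0 = B g reads
    2 a(g, e_0) <= a(g, e_0) + c sum_j |v_j|^2, so a(g, B g) <= c Cst |e_0|^2
    enters the Chebyshev bound. *)
Lemma pcg_energy_bound (S : 'Hom(W, R^o) -> W) (ft : 'Hom(W, R^o)) uht uh
    (Cst : R) vs m :
  (forall v, S (energy_op a v) = B v) -> (forall v, a uht v = ft v) ->
  (forall j, vs j \in Ws j) -> uht - uh = \sum_j vs j -> 0 <= c ->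
  \sum_j a (vs j) (vs j) <= Cst * a (uht - uh) (uht - uh) ->
  (2 * m + 1)%:R ^+ 2 * a (uht - pcg a S ft m uh) (uht - pcg a S ft m uh)
    <= L * c * Cst * a (uht - uh) (uht - uh).
Proof.
move=> SB uht_sol vsP e0E c_ge0 Cst_le.
have [g gE] := stable_surj (uht - uh).
have [d] := chebyshev_bound g m; rewrite -gE => dK dE.
apply: le_trans (le_trans dE _).
  rewrite ler_wpM2l ?exprn_ge0 ?ler0n //.
  exact: (pcg_optimal SB B_sym stable_gt0 uht_sol).
have := B_stable g vsP; rewrite -e0E -gE mulr_natl mulr2n lerD2l => ge.
rewrite -!mulrA ler_pM2l // (le_trans ge) //.
by rewrite ler_wpM2l.
Qed.

End Convergence.

(** * Energy projections *)

Section Projections.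
Variables (R : realType) (W : vectType R) (a : {dot W for idfun}).
Implicit Types (U : {vspace W}) (u v w : W).

Lemma energy_young (t : R) u v : 2 * t * `|a u v| <= a u u + t ^+ 2 * a v v.
Proof.
have := energy_ge0 a (u + t *: v); have := energy_ge0 a (u - t *: v).
rewrite !energy_linE (energyC a v u); case: (ger0P (a u v)) => _; lra.
Qed.

Lemma aproj_mem U v : aproj a U v \in U.
Proof. by have [] := aprojP a U v. Qed.

Lemma aproj_testl U v w : w \in U -> a (aproj a U v) w = a v w.
Proof.
move=> wU; have [_ /mem_orthovP/(_ w wU) vPw] := aprojP a U v.
have {}vPw : a (v - aproj a U v) w = 0 by exact: vPw.
by apply/esym/eqP; rewrite -subr_eq0 -energyNl -energyDl vPw.
Qed.

Lemma galerkin_energy_op U v : galerkin a U (energy_op a v) = aproj a U v.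
Proof.
apply/esym/galerkin_uniq; first exact: aproj_mem.
by move=> w wU; rewrite energy_opE aproj_testl.
Qed.

Lemma aproj_is_linear U : linear (aproj a U).
Proof.
move=> k u v; rewrite -[LHS]galerkin_energy_op; apply/esym/galerkin_uniq.
  by rewrite rpredD ?rpredZ ?aproj_mem.
by move=> w wU; rewrite energy_opE !energy_linE !aproj_testl.
Qed.

HB.instance Definition _ U := GRing.isLinear.Build R W W _ (aproj a U)
  (@aproj_is_linear U).

Lemma aproj_sym U v w : a (aproj a U v) w = a v (aproj a U w).
Proof.
rewrite energyC -(aproj_testl w (aproj_mem U v)) energyC.
by rewrite aproj_testl ?aproj_mem.
Qed.

Lemma aproj_sqr U v : a (aproj a U v) (aproj a U v) = a v (aproj a U v).
Proof. by rewrite aproj_testl ?aproj_mem. Qed.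

End Projections.

(** * The additive smoother *)

Section Additive.
Variables (R : realType) (W : vectType R) (a : {dot W for idfun}).
Variables (J : nat) (Ws : 'I_J -> {vspace W}).

Definition add_op : 'End(W) := \sum_j linfun (aproj a (Ws j)).

Lemma add_opE v : add_op v = \sum_j aproj a (Ws j) v.
Proof. by rewrite sum_lfunE; under eq_bigr do rewrite lfunE. Qed.

Lemma Sadd_energy_op v : Sadd a Ws (energy_op a v) = add_op v.
Proof.
by rewrite add_opE; apply: eq_bigr => j _; rewrite galerkin_energy_op.
Qed.

Lemma add_op_sym v w : a (add_op v) w = a v (add_op w).
Proof.
rewrite !add_opE energyC !energy_sumr; apply: eq_bigr => j _.
by rewrite energyC aproj_sym.
Qed.

Lemma add_op_energy v :
  a v (add_op v) = \sum_j a (aproj a (Ws j) v) (aproj a (Ws j) v).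
Proof. by rewrite add_opE energy_sumr; under eq_bigr do rewrite -aproj_sqr. Qed.

(** The local corrections P_j v are a decomposition of B v. *)
Lemma add_op_le (Creg : R) v :
  (forall (v : W) (vs : 'I_J -> W),
     (forall j, vs j \in Ws j) -> v = \sum_(j < J) vs j ->
     energy_norm a v ^+ 2 <= Creg * \sum_(j < J) energy_norm a (vs j) ^+ 2) ->
  a (add_op v) (add_op v) <= Creg * a v (add_op v).
Proof.
move=> A2; have := A2 _ _ (fun j => aproj_mem a (Ws j) v) (add_opE v).
rewrite energy_normE add_op_energy.
by under eq_bigr do rewrite energy_normE.
Qed.

(** On the j-th subspace g can be replaced by P_j g. *)
Lemma add_op_stable g (vs : 'I_J -> W) : (forall j, vs j \in Ws j) ->
  2 * a g (\sum_j vs j) <= a g (add_op g) + 1 * \sum_j a (vs j) (vs j).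
Proof.
move=> vsP; rewrite mul1r add_op_energy -big_split energy_sumr mulr_sumr.
apply: ler_sum => j _ /=; rewrite -(aproj_testl a g (vsP j)).
have := energy_young a 1 (aproj a (Ws j) g) (vs j); rewrite expr1n mulr1 mul1r.
by apply: le_trans; rewrite ler_pM2l // ler_norm.
Qed.

End Additive.

(** * The symmetrized multiplicative smoother *)

Section Multiplicative.
Variables (R : realType) (W : vectType R) (a : {dot W for idfun}).
Variables (J : nat) (Ws : 'I_J -> {vspace W}).
Implicit Types (s : seq 'I_J) (u v w : W) (i j : 'I_J).

(** Error propagation of a sweep: the product of the complementary projections
    1 - P_j, the first entry of s acting first. *)
Fixpoint sweep_err s v : W :=
  if s is j :: s' then sweep_err s' (v - aproj a (Ws j) v) else v.

Lemma sweep_err_is_linear s : linear (sweep_err s).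
Proof.
elim: s => //= j s IHs k u v; rewrite linearP opprD addrACA -scalerBr.
exact: IHs.
Qed.

HB.instance Definition _ s := GRing.isLinear.Build R W W _ (sweep_err s)
  (@sweep_err_is_linear s).

Lemma sweep_err_cat s1 s2 v :
  sweep_err (s1 ++ s2) v = sweep_err s2 (sweep_err s1 v).
Proof. by elim: s1 v => //= j s1 IHs v; rewrite IHs. Qed.

Lemma sweep_energy_op s v : sweep a Ws s (energy_op a v) = v - sweep_err s v.
Proof.
rewrite /sweep -[in X in _ = _ - X](subr0 v); move: (0 : W).
elim: s => [|j s IHs] e /=; first by rewrite subKr.
have -> : energy_op a v - energy_op a e = energy_op a (v - e).
  by rewrite -[energy_op a e]scale1r energy_op_sub_scale scale1r.
by rewrite galerkin_energy_op IHs opprD addrA.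
Qed.

(** Each 1 - P_j is self-adjoint, so the adjoint reverses the order. *)
Lemma sweep_err_rev s v w :
  a (sweep_err s v) w = a v (sweep_err (rev s) w).
Proof.
elim: s v w => //= j s IHs v w.
by rewrite IHs rev_cons -cats1 sweep_err_cat /= !energy_linE aproj_sym.
Qed.

Lemma sub_aproj_sqr i v :
  a (v - aproj a (Ws i) v) (v - aproj a (Ws i) v) =
  a v v - a (aproj a (Ws i) v) (aproj a (Ws i) v).
Proof. rewrite !energy_linE (energyC a _ v) aproj_sqr; ring. Qed.

Lemma sweep_err_le s v : a (sweep_err s v) (sweep_err s v) <= a v v.
Proof.
elim: s v => //= j s IHs v; apply: le_trans (IHs _) _.
by rewrite sub_aproj_sqr gerBl energy_ge0.
Qed.

(** d i is the correction made when the sweep visits i, namely P_i applied to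
    the current error. The energy lost is the sum of the energies of these
    corrections. For w in the j-th subspace the error left after visiting j is
    orthogonal to w, so a(v, w) only sees the corrections made up to then. *)
Lemma sweep_increments s v : uniq s ->
  exists d : 'I_J -> W, [/\ forall i, d i \in Ws i,
    \sum_(i <- s) a (d i) (d i) = a v v - a (sweep_err s v) (sweep_err s v)
  & forall j w, j \in s -> w \in Ws j ->
      `|a v w| <= \sum_(i <- s) `|a (d i) w|].
Proof.
elim: s v => [|i s IHs] v /=.
  by exists (fun=> 0); split=> [j||//]; rewrite ?mem0v // big_nil subrr.
move=> /andP[iNs /(IHs (v - aproj a (Ws i) v))[d [dP dE d_le]]].
exists (fun j => if j == i then aproj a (Ws i) v else d j).
have d_eq (F : W -> R) :
  \sum_(j <- s) F (if j == i then aproj a (Ws i) v else d j) =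
  \sum_(j <- s) F (d j).
  rewrite big_seq [RHS]big_seq; apply: eq_bigr => j js.
  by case: eqP => // ji; rewrite -ji js in iNs.
split=> [j||j w].
- by case: eqP => [->|_]; rewrite ?aproj_mem.
- by rewrite big_cons eqxx (d_eq (fun u => a u u)) dE sub_aproj_sqr addrA
    subrKC.
rewrite big_cons eqxx (d_eq (fun u => `|a u w|)) inE.
case: eqP => [-> _ wi|_ /= js wj].
  by rewrite aproj_testl // lerDl sumr_ge0.
rewrite -[v in `|a v w|](subrK (aproj a (Ws i) v)) energyDl addrC.
by rewrite (le_trans (ler_normD _ _)) // lerD2l (d_le j).
Qed.

(** With G the error propagation of the forward sweep, this is
    1 - G' G, where G' is the adjoint of G. *)
Definition mult_op : 'End(W) :=
  linfun (idfun \- (sweep_err (rev (enum 'I_J)) \o sweep_err (enum 'I_J))).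

Lemma mult_opE v : mult_op v =
  v - sweep_err (rev (enum 'I_J)) (sweep_err (enum 'I_J) v).
Proof. by rewrite lfunE. Qed.

Lemma Smult_sym_energy_op v : Smult_sym a Ws (energy_op a v) = mult_op v.
Proof.
rewrite /Smult_sym /Smult /Smult_t !sweep_energy_op mult_opE.
rewrite (linearB (sweep_err (rev _))) /= opprB addrC addrA subrK.
by rewrite addrC addrA subrK.
Qed.

Lemma mult_op_sym v w : a (mult_op v) w = a v (mult_op w).
Proof. by rewrite !mult_opE !energy_linE sweep_err_rev revK sweep_err_rev. Qed.

Lemma mult_op_energy v : a v (mult_op v) =
  a v v - a (sweep_err (enum 'I_J) v) (sweep_err (enum 'I_J) v).
Proof. by rewrite mult_opE !energy_linE -sweep_err_rev. Qed.

(** B - B^2 = G' (1 - G G') G is nonnegative since the reversed sweep, the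
    adjoint G' of G, is a contraction. *)
Lemma mult_op_le v : a (mult_op v) (mult_op v) <= 1 * a v (mult_op v).
Proof.
rewrite mul1r {1}mult_opE energyDl energyNl gerBl sweep_err_rev revK.
rewrite mult_opE linearB /=.
rewrite !energy_linE subr_ge0.
by have := sweep_err_le (rev (enum 'I_J)) (sweep_err (enum 'I_J) v);
  rewrite sweep_err_rev revK.
Qed.

End Multiplicative.

Section Overlap.
Variables (R : realType) (W : vectType R) (a : {dot W for idfun}).
Variables (J : nat) (Ws : 'I_J -> {vspace W}).

Definition interact (i j : 'I_J) : bool :=
  (aproj a (Ws i) @` [set` Ws j])%classic != [set 0 : W]%classic.

Lemma interactPn i j : reflect
  (forall u w, u \in Ws i -> w \in Ws j -> a u w = 0) (~~ interact i j).
Proof.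
rewrite negbK; apply: (iffP eqP) => [Pij0 u w ui wj|orth].
  have /= Pw0 : ([set 0 : W]%classic) (aproj a (Ws i) w).
    by rewrite -Pij0; exists w.
  by rewrite energyC -(aproj_testl _ _ ui) Pw0 energy0l.
apply/seteqP; split=> [_ [w /= wj <-]|_ -> /=].
  by apply/eqP; rewrite -(energy_eq0 a) aproj_sqr energyC orth ?aproj_mem.
by exists 0; [exact: mem0v|rewrite linear0].
Qed.

(** Interaction means that the two subspaces are not orthogonal. So the bound M
    on the number of neighbours holds for rows as well as for columns of the
    interaction relation. *)
Lemma interact_sym i j : interact i j = interact j i.
Proof.
apply: negb_inj; apply/idP/idP => /interactPn orth;
  by apply/interactPn => u w ui wj; rewrite energyC orth.
Qed.

Lemma card_interact_le j : (#|[pred i | interact i j]| <= max_overlap a Ws)%N.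
Proof. by apply: (leq_bigmax (F := fun j => #|[pred i | interact i j]|)). Qed.

Lemma sum_interact_le (X : 'I_J -> R) : (forall i, 0 <= X i) ->
  \sum_j \sum_(i | interact i j) X j <= (max_overlap a Ws)%:R * \sum_j X j.
Proof.
move=> X_ge0; rewrite mulr_sumr; apply: ler_sum => j _.
rewrite sumr_const -[X j *+ _]mulr_natl ler_wpM2r ?ler_nat //.
exact: card_interact_le.
Qed.

(** By [sweep_increments], a(g, sum_j v_j) is at most the sum of |a(d_i, v_j)|
    over interacting pairs. Young's inequality with weight M splits each term,
    and each index occurs in at most M pairs, which gives the two factors M. *)
Lemma mult_op_stable g (vs : 'I_J -> W) : (forall j, vs j \in Ws j) ->
  2 * a g (\sum_j vs j) <=
  a g (mult_op a Ws g) + (max_overlap a Ws)%:R ^+ 2 * \sum_j a (vs j) (vs j).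
Proof.
move=> vsP; set M : R := (max_overlap a Ws)%:R.
have [d [dP dE d_le]] := sweep_increments a Ws g (enum_uniq 'I_J).
rewrite mult_op_energy -dE big_enum /=.
have pair_le : a g (\sum_j vs j) <=
    \sum_j \sum_(i | interact i j) `|a (d i) (vs j)|.
  rewrite energy_sumr; apply: ler_sum => j _.
  rewrite (le_trans (ler_norm _)) //.
  rewrite (le_trans (d_le j _ _ (vsP j))) ?mem_enum //.
  rewrite big_enum /= (bigID (fun i => interact i j)) /= gerDl big1 // => i.
  by move=> /interactPn ->; rewrite ?normr0.
have X_ge0 i : 0 <= a (d i) (d i) by apply: energy_ge0.
have Y_ge0 j : 0 <= a (vs j) (vs j) by apply: energy_ge0.
(* If M = 0 there are no interacting pairs, and Young's weight degenerates. *)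
have [M0|M_gt0] : M = 0 \/ 0 < M.
  have := ler0n R (max_overlap a Ws); rewrite le_eqVlt.
  by move=> /predU1P[]; [left|right].
  have no_pair i j : interact i j = false.
    apply: contraFF (ltn0 #|[pred i | interact i j]|) => ij.
    move/eqP: M0; rewrite pnatr_eq0 => /eqP M0.
    have := card_interact_le j; rewrite M0 leqn0 => /eqP/card0_eq/(_ i).
    by rewrite inE ij.
  rewrite M0 expr0n mul0r addr0 (@le_trans _ _ 0) ?sumr_ge0 //.
  rewrite pmulr_rle0 // (le_trans pair_le) // big1 // => j _.
  by apply: big_pred0 => i; rewrite no_pair.
rewrite -(ler_pM2l M_gt0) mulrDr.
apply: (@le_trans _ _ (\sum_j \sum_(i | interact i j)
    (a (d i) (d i) + M ^+ 2 * a (vs j) (vs j)))).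
  rewrite mulrA (mulrC M); have twoM_ge0 : 0 <= 2 * M by rewrite mulr_ge0 ?ltW.
  apply: le_trans (ler_wpM2l twoM_ge0 pair_le) _; rewrite mulr_sumr.
  apply: ler_sum => j _; rewrite mulr_sumr; apply: ler_sum => i _.
  exact: energy_young.
rewrite (eq_bigr (fun j => \sum_(i | interact i j) a (d i) (d i) +
    \sum_(i | interact i j) M ^+ 2 * a (vs j) (vs j))); last first.
  by move=> j _; rewrite big_split.
rewrite big_split /= lerD //.
  rewrite (exchange_big_dep predT) //= (eq_bigr (fun i =>
    \sum_(j | interact j i) a (d i) (d i))).
    exact: sum_interact_le.
  by move=> i _; apply: eq_bigl => j; rewrite interact_sym.
rewrite -/M (mulr_sumr _ _ _ (M ^+ 2)).
apply: (@sum_interact_le (fun j => M ^+ 2 * a (vs j) (vs j))) => j.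
by rewrite mulr_ge0 // exprn_ge0 // ltW.
Qed.

End Overlap.

(** * Passing to the exact solution *)

Section ExactSolution.
Variables (R : realType) (W : vectType R) (a : {dot W for idfun}).

Lemma energy_norm_le (v w : W) (eps : R) : 0 <= eps ->
  a v v <= eps ^+ 2 * a w w -> energy_norm a v <= eps * energy_norm a w.
Proof.
move=> eps_ge0 vw; rewrite -[eps in X in _ <= X]ger0_norm // -sqrtr_sqr.
by rewrite -sqrtrM ?sqr_ge0 // ler_sqrt // mulr_ge0 ?sqr_ge0 ?energy_ge0.
Qed.

(** Both triangle inequalities go through uht, once for the iterate and once
    for the initial guess. *)
Lemma seminorm_transfer (E : lmodType R) (iota : {linear W -> E}) (u : E)
    (N : E -> R) (uh uht um : W) (eps : R) :
  energy_seminorm_ext a iota u N -> 0 <= eps ->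
  energy_norm a (uht - um) <= eps * energy_norm a (uht - uh) ->
  N (u - iota um) <= (1 + eps) * N (u - iota uht) + eps * N (u - iota uh).
Proof.
move=> [N_ge0 NZ ND Niota] eps_ge0 contr.
set D := [set x | _]%classic in N_ge0 NZ ND.
have Diota v : D (iota v) by exists v, 0; rewrite scale0r addr0.
have Du v : D (u - iota v) by exists (- v), 1; rewrite linearN scale1r addrC.
have N_um : N (u - iota um) <= N (u - iota uht) + energy_norm a (uht - um).
  have -> : u - iota um = (u - iota uht) + iota (uht - um).
    by rewrite linearB addrA subrK.
  by rewrite (le_trans (ND _ _ (Du _) (Diota _))) // Niota.
have e0_le : energy_norm a (uht - uh) <= N (u - iota uh) + N (u - iota uht).
  rewrite -Niota (_ : iota _ = (u - iota uh) + (-1) *: (u - iota uht)).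
    have D' : D (-1 *: (u - iota uht)).
      by exists uht, (-1); rewrite scalerBr !scaleN1r opprK addrC.
    rewrite (le_trans (ND _ _ (Du _) D')) // NZ // normrN1 mul1r //.
  by rewrite scaleN1r opprB linearB [RHS]addrC subrKA.
have := ler_wpM2l eps_ge0 e0_le.
by rewrite mulrDr mulrDl mul1r; lra.
Qed.

End ExactSolution.

Theorem corollary2p6 (R : realType) (W : vectType R) (a : {dot W for idfun})
  (V : {vspace W}) (J : nat) (hJ : (0 < J)%N) (Ws : 'I_J -> {vspace W})
  (f : 'Hom(subvs_of V, R^o)) (ft : 'Hom(W, R^o))
  (hft : forall v : subvs_of V, ft (vsval v) = f v)
  (uh : W) (uh_V : uh \in V)
  (uh_sol : forall v : subvs_of V, a uh (vsval v) = f v)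
  (uht : W) (uht_sol : forall v : W, a uht v = ft v)
  (E : lmodType R) (iota : {linear W -> E}) (iota_inj : injective iota)
  (u : E) (N : E -> R) (hN : energy_seminorm_ext a iota u N)
  (hW : (\sum_(j < J) Ws j)%VS = fullv)
  (Cst Creg : R) (Cst_gt0 : 0 < Cst) (Creg_gt0 : 0 < Creg)
  (A1 : forall v, v \in orthov a V ->
     exists vs : 'I_J -> W,
       [/\ forall j, vs j \in Ws j,
           v = \sum_(j < J) vs j
         & \sum_(j < J) energy_norm a (vs j) ^+ 2
             <= Cst * energy_norm a v ^+ 2])
  (A2 : forall (v : W) (vs : 'I_J -> W),
     (forall j, vs j \in Ws j) -> v = \sum_(j < J) vs j ->
     energy_norm a v ^+ 2 <= Creg * \sum_(j < J) energy_norm a (vs j) ^+ 2)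
  (m : nat) (hm : (1 <= m)%N)
  (S : 'Hom(W, R^o) -> W) (eps : R)
  (hS : (S = Sadd a Ws /\
         eps = Num.sqrt (Creg * Cst) / (2 * m + 1)%:R)
     \/ (S = Smult_sym a Ws /\
         eps = Num.sqrt (Cst * (max_overlap a Ws)%:R ^+ 2) / (2 * m + 1)%:R)) :
  N (u - iota (pcg a S ft m uh)) <=
    (1 + eps) * N (u - iota uht) + eps * N (u - iota uh).
Proof.
have e0V : uht - uh \in orthov a V.
  apply/mem_orthovP => v vV.
  have := uh_sol (Subvs vV); rewrite -hft /= => uhv.
  have : a (uht - uh) v = 0 by rewrite !energy_linE uht_sol uhv subrr.
  exact.
have [vs [vsP e0E]] := A1 _ e0V.
rewrite energy_normE; under eq_bigr do rewrite energy_normE; move=> vs_le.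
have n_gt0 : 0 < (2 * m + 1)%:R :> R by rewrite ltr0n addn1.
(* Both rates have this form: k is L c Cst for the smoother at hand. *)
suff [k [k_ge0 epsE] energy_le] : exists2 k : R, 0 <= k /\
    eps = Num.sqrt k / (2 * m + 1)%:R & (2 * m + 1)%:R ^+ 2 *
      a (uht - pcg a S ft m uh) (uht - pcg a S ft m uh)
      <= k * a (uht - uh) (uht - uh).
  have eps_ge0 : 0 <= eps by rewrite epsE divr_ge0 ?sqrtr_ge0 ?ltW.
  apply: seminorm_transfer hN eps_ge0 (energy_norm_le eps_ge0 _).
  rewrite epsE expr_div_n sqr_sqrtr // mulrAC ler_pdivlMr ?exprn_gt0 //.
  by rewrite mulrC.
have M2_ge0 : 0 <= (max_overlap a Ws)%:R ^+ 2 :> R by exact: sqr_ge0.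
case: hS => -[-> epsE].
  exists (Creg * Cst); first by split=> //; rewrite mulr_ge0 ?ltW.
  rewrite -[Creg]mulr1.
  apply: (@pcg_energy_bound _ _ _ (add_op a Ws) Creg Creg_gt0 _ _ _ Ws 1 hW)
    vs_le => //.
  - exact: add_op_sym.
  - by move=> v; exact: (add_op_le v A2).
  - exact: add_op_stable.
  - exact: Sadd_energy_op.
exists (Cst * (max_overlap a Ws)%:R ^+ 2).
  by split=> //; rewrite mulr_ge0 // ltW.
rewrite [Cst * _]mulrC -[(max_overlap a Ws)%:R ^+ 2]mul1r.
apply: (@pcg_energy_bound _ _ _ (mult_op a Ws) 1 ltr01 _ _ _ Ws) vs_le => //.
- exact: mult_op_sym.
- exact: mult_op_le.
- exact: mult_op_stable.
- exact: Smult_sym_energy_op.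
Qed.
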